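(* Let $K$ be a field, and let $I\subset R=K[x_1,\dots,x_n]$ and $J\subset T=K[y_1,\dots,y_m]$ be proper nonzero homogeneous ideals. Let $S=R\otimes_K T=K[x_1,\dots,x_n,y_1,\dots,y_m]$, and denote the extended ideals $IS$ and $JS$ again by $I$ and $J$. Suppose that $\mathrm{v}(I^k)<\operatorname{reg}(I^k)$ and $\mathrm{v}(J^k)<\operatorname{reg}(J^k)$ for all $k\gg0$. Then $\mathrm{v}((IJ)^k)<\operatorname{reg}((IJ)^k)$ for all $k\gg0$.
   Context: Polynomial rings are standard graded. For an ideal $L$ of a polynomial ring $S$, $\operatorname{Ass}(L)$ denotes the set of associated primes of $S/L$. For a proper graded ideal $L$ and $\mathfrak{p}\in\operatorname{Ass}(L)$, $\mathrm{v}_{\mathfrak{p}}(L)$ is the least degree of a homogeneous polynomial $f$ such that $(L:f)=\mathfrak{p}$, and $\mathrm{v}(L)=\min_{\mathfrak{p}\in\operatorname{Ass}(L)}\mathrm{v}_{\mathfrak{p}}(L)$. $\operatorname{reg}(L)$ is the Castelnuovo–Mumford regularity of $L$ as a graded module. ''For all $k\gg0$'' means for all sufficiently large integers $k$. *)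

(* Defs.v *)
From mathcomp Require Export all_boot all_order all_algebra.
From mathcomp Require Export boolp ring_quotient.
From mathcomp Require Export mpoly.

Set Implicit Arguments.
Unset Strict Implicit.
Unset Printing Implicit Defensive.

Import GRing.Theory.
Local Open Scope ring_scope.

(* Subsets of a ring are collective boolean predicates, as in ring_quotient;
   since [`[< P >]] turns any proposition into a boolean, this is no
   restriction.  The library predicate [idealr_closed] says "proper ideal". *)

Section Ideals.
Variable R : comNzRingType.
Implicit Types (G : R -> Prop) (L M p : {pred R}).

Definition ideal_span G : {pred R} :=
  [pred x | `[< exists s : seq (R * R),
                  (forall c, c \in s -> G c.2) /\
                  x = \sum_(c <- s) c.1 * c.2 >]].

Definition ideal_mul L M : {pred R} :=
  ideal_span (fun x => exists2 a, a \in L & exists2 b, b \in M & x = a * b).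

Definition ideal_exp L (k : nat) : {pred R} := iter k (ideal_mul L) predT.

Definition colon L (f : R) : {pred R} := [pred g | g * f \in L].

Definition prime_ideal p : Prop := idealr_closed p /\ prime_idealr_closed p.

Definition associated_prime L p : Prop :=
  prime_ideal p /\ exists f, colon L f =i p.

End Ideals.

Definition ideal_ext (R S : comNzRingType) (h : R -> S) (L : {pred R}) :
  {pred S} := ideal_span (fun y => exists2 x, x \in L & y = h x).

Section Graded.
Variables (K : fieldType) (n : nat).
Local Notation S := {mpoly K[n]}.
Implicit Types (L p : {pred S}) (d r : nat).

Definition homogeneous_ideal L : Prop :=
  forall (f : S) d, f \in L -> pihomog mdeg d f \in L.

(* The zero polynomial is d.-homog for every d, but it never satisfies
   (L : f) = p for a prime, hence proper, ideal p. *)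
Definition is_local_vnumber L p d : Prop :=
  (exists2 f : S, f \is d.-homog & colon L f =i p) /\
  (forall (e : nat) (f : S), f \is e.-homog -> colon L f =i p -> (d <= e)%N).

Definition is_vnumber L d : Prop :=
  (exists2 p : {pred S}, associated_prime L p & is_local_vnumber L p d) /\
  (forall (p : {pred S}) (e : nat),
     associated_prime L p -> is_local_vnumber L p e -> (d <= e)%N).

(* Minimal graded free resolution
     ... -> F_2 -> F_1 -> F_0 -> L -> 0,   F_i = \bigoplus_j S(- deg i j),
   where F_i has finite rank [rk i] and its elements are row vectors, on which
   the matrices act on the right.  The maps are homogeneous of degree 0: the
   (j, k) entry of [diff i] is homogeneous of degree deg (i+1) j - deg i k, and
   zero when this difference is negative.  Twists by natural numbers suffice,
   because L lives in nonnegative degrees and the resolution is minimal. *)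
Record min_graded_free_res L := MinGradedFreeRes {
  rk : nat -> nat;
  deg : forall i, 'I_(rk i) -> nat;
  aug : 'cV[S]_(rk 0);
  diff : forall i, 'M[S]_(rk i.+1, rk i);
  aug_homog : forall j, aug j 0 \is (deg j).-homog;
  diff_homog : forall i j k m,
    m \in msupp (diff i j k) -> (mdeg m + deg k = deg j)%N;
  aug_image : forall f : S,
    f \in L <-> exists v : 'rV[S]_(rk 0), (v *m aug) 0 0 = f;
  aug_exact : forall v : 'rV[S]_(rk 0),
    v *m aug = 0 <-> exists w : 'rV[S]_(rk 1), v = w *m diff 0;
  diff_exact : forall i (v : 'rV[S]_(rk i.+1)),
    v *m diff i = 0 <-> exists w : 'rV[S]_(rk i.+2), v = w *m diff i.+1;
  (* zero constant terms: the image of F_(i+1) lies in (x_1, ..., x_n) F_i *)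
  diff_minimal : forall i j k, (diff i j k)@_0%MM = 0
}.

(* reg L = max {j - i | S(-j) is a summand of F_i} *)
Definition is_regularity L r : Prop :=
  exists F : min_graded_free_res L,
    (exists i (j : 'I_(rk F i)), deg j = (r + i)%N) /\
    (forall i (j : 'I_(rk F i)), (deg j <= r + i)%N).

(* v(L) < reg(L) *)
Definition vnumber_lt_reg L : Prop :=
  exists d r, [/\ is_vnumber L d, is_regularity L r & (d < r)%N].

End Graded.

(* The inclusions of K[x_1..x_n] and K[y_1..y_m] in K[x_1..x_n, y_1..y_m];
   the last m variables are the y's. *)
Definition incl_l (K : fieldType) (n m : nat) (f : {mpoly K[n]}) :
  {mpoly K[n + m]} := f \mPo [tuple 'X_(lshift m i) | i < n].

Definition incl_r (K : fieldType) (n m : nat) (g : {mpoly K[m]}) :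
  {mpoly K[n + m]} := g \mPo [tuple 'X_(rshift n i) | i < m].

(* Main.v *)
(** Put [L1 = I^k] and [L2 = J^k], so that [(IJ)^k = L1 L2] in the big ring.

    v-number: if [(L1 : f) = p] and [g] is a nonzero generator of [L2], then
    [(L1 L2 : f g)] is the extension of [p], which is prime; hence
    [v(L1 L2) <= v(L1) + deg g <= v(L1) + reg L2].

    Regularity: [L1 L2] is the tensor product of [L1] and [L2] over [K], so it
    is resolved by the tensor product of the minimal resolutions [F] and [G],
    and [reg (L1 L2) = reg L1 + reg L2].  Exactness comes from [K]-linear
    contracting homotopies [s] of the augmented complex [F] and [t] of [G],
    extended coefficientwise to the big ring: on the tensor product,
    [s (x) 1 + s_0 d_0 (x) t] contracts every cycle killed by the
    augmentation. *)

From HB Require Import structures.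
From mathcomp Require Import ssrcomplements.
Require Import Defs.
Set Implicit Arguments.
Unset Strict Implicit.
Unset Printing Implicit Defensive.
Import GRing.Theory.
Local Open Scope ring_scope.

(** * Operators on vectors of polynomials *)

Section LinearExtension.
Variables (K : fieldType) (n : nat) (V : lmodType K).
Local Notation A := {mpoly K[n]}.

(** Monomials form a [K]-basis, so a [K]-linear map can be prescribed on them at will. The
    homotopies are built this way; in general they are linear over [K] only. *)
Definition linext (phi : 'X_{1..n} -> V) (p : A) : V :=
  \sum_(m <- msupp p) p@_m *: phi m.

(** A bounded index set shared by several polynomials replaces their individual supports, which
    turns linearity into a termwise identity. *)
Lemma linextwE phi k (p : A) : (msize p <= k)%N ->
  linext phi p = \sum_(m : 'X_{1..n < k}) p@_m *: phi m.
Proof.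
move=> le_pk; rewrite /linext (big_mksub 'X_{1..n < k}) ?msupp_uniq //=.
  rewrite big_rmcond //= => j /memN_msupp_eq0 ->.
  by rewrite scale0r.
by move=> x /msize_mdeg_lt /leq_trans; apply.
Qed.

Fact linext_is_linear phi : linear (linext phi).
Proof.
move=> c p q; pose k := maxn (msize (c *: p + q)) (maxn (msize p) (msize q)).
rewrite !(@linextwE _ k) /k ?leq_max ?leqnn ?orbT //.
rewrite scaler_sumr -big_split; apply: eq_bigr => m _ /=.
by rewrite mcoeffD mcoeffZ scalerDl scalerA.
Qed.

HB.instance Definition _ phi :=
  GRing.isLinear.Build K A V _ (linext phi) (linext_is_linear phi).

Lemma linextX phi m : linext phi 'X_[m] = phi m.
Proof. by rewrite /linext msuppX big_seq1 mcoeffX eqxx scale1r. Qed.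

End LinearExtension.

Section OperatorMatrix.
Variables (K : fieldType) (B : comAlgType K).

(** A [K]-linear map of free modules, given by the matrix of its components. It acts on each row of
    [v] separately, so one operator serves for vectors and for matrices. *)
Definition opr r p q (s : 'I_p -> 'I_q -> {linear B -> B}) (v : 'M[B]_(r, p)) :
  'M[B]_(r, q) := \matrix_(x, b) \sum_a s a b (v x a).

Variables (p q : nat) (s : 'I_p -> 'I_q -> {linear B -> B}).

Lemma oprB r : {morph @opr r _ _ s : u v / u - v}.
Proof.
move=> u v; apply/matrixP => x b; rewrite !mxE -sumrB.
by apply: eq_bigr => a _; rewrite !mxE raddfB.
Qed.

Lemma opr0 r : @opr r _ _ s 0 = 0.
Proof. by rewrite -(subr0 0) oprB subrr. Qed.

Lemma oprN r : {morph @opr r _ _ s : u / - u}.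
Proof. by move=> u; rewrite -sub0r oprB opr0 sub0r. Qed.

Lemma oprD r : {morph @opr r _ _ s : u v / u + v}.
Proof. by move=> u v; rewrite -[v]opprK oprB [in RHS]oprN. Qed.

Lemma oprZ r (c : B) (v : 'M[B]_(r, p)) :
  (forall a b x, s a b (c * x) = c * s a b x) -> opr s (c *: v) = c *: opr s v.
Proof.
move=> sc; apply/matrixP => x b; rewrite !mxE mulr_sumr.
by apply: eq_bigr => a _; rewrite mxE sc.
Qed.

Lemma oprMl r r' (M : 'M[B]_(r', r)) (v : 'M[B]_(r, p)) :
  (forall a b i j x, s a b (M i j * x) = M i j * s a b x) ->
  opr s (M *m v) = M *m opr s v.
Proof.
move=> sM; apply/matrixP => x b; rewrite !mxE.
under eq_bigr => a _ do rewrite mxE raddf_sum.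
rewrite exchange_big; apply: eq_bigr => j _; rewrite mxE mulr_sumr.
by apply: eq_bigr => a _; exact: sM.
Qed.

Lemma row_opr r (v : 'M[B]_(r, p)) x : row x (opr s v) = opr s (row x v).
Proof.
by apply/rowP => b; rewrite !mxE; apply: eq_bigr => a _; rewrite mxE.
Qed.

End OperatorMatrix.

Section Contraction.
Variables (K : fieldType) (n : nat).
Local Notation A := {mpoly K[n]}.

Lemma mpoly_row_ind p (P : 'rV[A]_p -> Prop) :
  P 0 -> (forall u v, P u -> P v -> P (u + v)) ->
  (forall c m a, P (c%:MP *: ('X_[m] *: delta_mx 0 a))) -> forall v, P v.
Proof.
move=> P0 PD PX v; rewrite (row_sum_delta v).
apply: big_ind => // a _; rewrite (mpolyE (v 0 a)) scaler_suml.
by apply: big_ind => // m _; rewrite -mul_mpolyC -scalerA.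
Qed.

(** Preimages under [d] are chosen on the [K]-basis ['X_[m] *: delta_mx 0 a] and extended
    [K]-linearly. The choice [w] need not be additive, so only its values on basis vectors enter. *)
Lemma operator_lift p c q (d : 'M[A]_(q, c)) (Phi : 'rV[A]_p -> 'rV[A]_c) :
  {morph Phi : u v / u + v} ->
  (forall x v, Phi (x%:MP *: v) = x%:MP *: Phi v) ->
  (forall v, exists w : 'rV[A]_q, Phi v = w *m d) ->
  exists s : 'I_p -> 'I_q -> {linear A -> A},
    forall v, opr s v *m d = Phi v.
Proof.
move=> PhiD PhiZ ex_lift.
have [w wE] := choice ex_lift.
pose s a b : {linear A -> A} :=
  linext (fun m => w ('X_[m] *: delta_mx 0 a) 0 b).
have sC x a b f : s a b (x%:MP * f) = x%:MP * s a b f.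
  by rewrite !mul_mpolyC linearZ.
exists s; apply: mpoly_row_ind => [|u v Pu Pv|x m a].
- by rewrite opr0 mul0mx; apply/esym/(addrI (Phi 0)); rewrite -PhiD !addr0.
- by rewrite oprD mulmxDl Pu Pv PhiD.
rewrite oprZ; last by move=> *; exact: sC.
have -> : opr s ('X_[m] *: delta_mx 0 a) = w ('X_[m] *: delta_mx 0 a).
  apply/rowP => b; rewrite !mxE (bigD1 a) //= big1 ?addr0.
    by rewrite !mxE !eqxx mulr1 linextX.
  by move=> a' /negPf na; rewrite !mxE na andbF mulr0 raddf0.
by rewrite -scalemxAl PhiZ wE.
Qed.

(** As [s] is a section of [d] over the image of [d], every [v - opr s (v *m d)] is a cycle. By
    exactness it is a boundary, and [operator_lift] makes the preimage [K]-linear in [v]. *)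
Lemma contraction_step p q q' (d : 'M[A]_(q, p)) (d' : 'M[A]_(q', q))
    (s : 'I_p -> 'I_q -> {linear A -> A}) :
  (forall v : 'rV_q, v *m d = 0 -> exists w : 'rV_q', v = w *m d') ->
  (forall v : 'rV_q, opr s (v *m d) *m d = v *m d) ->
  exists s' : 'I_q -> 'I_q' -> {linear A -> A},
    forall v : 'rV_q, opr s' v *m d' = v - opr s (v *m d).
Proof.
move=> ex_d sd; apply: operator_lift => [u v|x v|v].
- by rewrite mulmxDl oprD opprD addrACA.
- rewrite -scalemxAl oprZ ?scalerBr // => a b f.
  by rewrite !mul_mpolyC linearZ.
by apply: ex_d; rewrite mulmxBl sd subrr.
Qed.

(* Normal forms with respect to leading monomials: [1 - rho] maps a polynomial
   to its unique representative modulo L without monomials in the set of leading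
   monomials of L. *)
Lemma subspace_projector (L : {pred A}) :
  0 \in L -> (forall c f g, f \in L -> g \in L -> c *: f + g \in L) ->
  exists rho : {linear A -> A},
    (forall f, rho f \in L) /\ (forall f, f \in L -> rho f = f).
Proof.
move=> L0 LP.
pose reduced (r : A) := forall f, f \in L -> f != 0 -> mlead f \notin msupp r.
have reducedP c r r' : reduced r -> reduced r' -> reduced (c *: r + r').
  move=> red red' f fL f0; apply: contra (red f fL f0) => /msuppD_le.
  by rewrite mem_cat (negPf (red' f fL f0)) orbF => /msuppZ_le.
have LB f g : f \in L -> g \in L -> f - g \in L.
  by move=> fL gL; rewrite addrC -scaleN1r LP.
(* Division by induction on the leading monomial: cancel the leading term against an element of [L]
   with that leading monomial if there is one, otherwise move it into the remainder. *)
have ex_nf f : exists r, f - r \in L /\ reduced r.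
  elim/mleadrect: f => f IH.
  have [-> | f0] := eqVneq f 0.
    by exists 0; rewrite subrr; split=> // g _ _; rewrite msupp0.
  have lower (g : A) : mlead g = mlead f -> g@_(mlead f) = f@_(mlead f) ->
      f - g = 0 \/ (mlead (f - g) < mlead f)%O.
    move=> lg cg; have [-> | fg0] := eqVneq (f - g) 0; [by left | right].
    rewrite Order.POrderTheory.lt_neqAle.
    have := mleadB_le f g; rewrite lg Order.JoinTheory.joinxx => ->.
    rewrite andbT; apply: contraNneq fg0 => lfg.
    by rewrite -mleadc_eq0 lfg mcoeffB cg subrr.
  have c0 : f@_(mlead f) != 0 by rewrite mleadc_eq0.
  have ex_nf0 : exists r, (0 : A) - r \in L /\ reduced r.
    by exists 0; rewrite subrr; split=> // g' _ _; rewrite msupp0.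
  case: (pselect (exists g, [/\ g \in L, g != 0 & mlead g = mlead f])).
    case=> g [gL g0 lg]; pose c := f@_(mlead f) / g@_(mlead g).
    have cg0 : g@_(mlead g) != 0 by rewrite mleadc_eq0.
    have c_neq0 : c != 0 by rewrite mulf_neq0 ?invr_neq0.
    have [r [rL red]] : exists r, (f - c *: g) - r \in L /\ reduced r.
      have [||-> //|/IH//] := lower (c *: g).
      - by rewrite mleadZ.
      - by rewrite mcoeffZ /c -lg mulfVK.
    exists r; split=> //.
    rewrite (_ : f - r = c *: g + (f - c *: g - r)); last first.
      by rewrite addrA addrCA subrr addr0.
    exact: LP.
  move=> nlead; pose t := f@_(mlead f) *: 'X_[mlead f].
  have [r [rL red]] : exists r, (f - t) - r \in L /\ reduced r.
    have [||-> //|/IH//] := lower t.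
    - by rewrite mleadZ // mleadXm.
    - by rewrite mcoeffZ mcoeffX eqxx mulr1.
  exists (t + r); split; first by rewrite opprD addrA.
  apply: reducedP => // g gL g0; rewrite msuppX inE.
  by apply/negP => /eqP lg; apply: nlead; exists g.
(* A difference of reduced polynomials is reduced, so it cannot be a nonzero element of [L].
   Uniqueness then makes [nf] linear. *)
have uniq_nf r r' : r - r' \in L -> reduced r -> reduced r' -> r = r'.
  move=> rr' red red'; apply/eqP; rewrite -subr_eq0; apply: contraT => nz.
  have := reducedP (-1) _ _ red' red _ rr' nz.
  by rewrite scaleN1r [- r' + r]addrC mlead_supp.
have [nf nfP] := choice ex_nf.
have nf_lin : linear (fun f => f - nf f).
  move=> c f g.
  have -> : nf (c *: f + g) = c *: nf f + nf g.
    have [hf rf] := nfP f; have [hg rg] := nfP g.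
    have [h r] := nfP (c *: f + g).
    apply: uniq_nf => //; last exact: reducedP.
    have -> : nf (c *: f + g) - (c *: nf f + nf g) =
        (c *: (f - nf f) + (g - nf g)) - (c *: f + g - nf (c *: f + g)).
      by rewrite scalerBr addrACA -opprD opprB [RHS]addrC addrA subrK.
    by apply: LB => //; apply: LP.
  by rewrite scalerBr addrACA -opprD.
pose rho_lin := GRing.isLinear.Build K A A _ _ nf_lin.
pose rho : {linear A -> A} := HB.pack (fun f => f - nf f) rho_lin.
exists rho; split=> f /=; first by case: (nfP f).
move=> fL; have [h r] := nfP f.
suff -> : nf f = 0 by rewrite subr0.
apply: uniq_nf => //; last by move=> g _ _; rewrite msupp0.
rewrite subr0 (_ : nf f = f - (f - nf f)); first exact: LB.
by rewrite opprB addrC subrK.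
Qed.

End Contraction.

Section ContractionExists.
Variables (K : fieldType) (n : nat).
Local Notation A := {mpoly K[n]}.

Lemma contraction_exists (p : nat -> nat) (d : forall i, 'M[A]_(p i.+1, p i))
    (s0 : 'I_(p 0) -> 'I_(p 1) -> {linear A -> A}) :
  (forall v : 'rV_(p 1), opr s0 (v *m d 0) *m d 0 = v *m d 0) ->
  (forall i (v : 'rV_(p i.+1)),
     v *m d i = 0 <-> exists w : 'rV_(p i.+2), v = w *m d i.+1) ->
  exists s : forall i, 'I_(p i) -> 'I_(p i.+1) -> {linear A -> A},
    forall i (v : 'rV_(p i.+1)),
      opr (s i.+1) v *m d i.+1 = v - opr (s i) (v *m d i).
Proof.
move=> s0_good exact_d.
pose op i := 'I_(p i) -> 'I_(p i.+1) -> {linear A -> A}.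
pose good i (s : op i) :=
  forall v : 'rV_(p i.+1), opr s (v *m d i) *m d i = v *m d i.
(* The recursion carries the invariant [good], that [s] is a section over the image of [d i]; this
   is what [contraction_step] requires in the next degree. *)
have step i (s : {s : op i | good i s}) : {s' : {s' : op i.+1 | good i.+1 s'} |
    forall v : 'rV_(p i.+1), opr (sval s') v *m d i.+1 = v - opr (sval s) (v *m d i)}.
  apply: cid; case: s => s sP /=.
  have [|s' s'E] := contraction_step (d' := d i.+1) _ sP.
    by move=> v /exact_d.
  have s'P : good i.+1 s'.
    move=> v; rewrite s'E.
    have -> : v *m d i.+1 *m d i = 0 by apply/exact_d; exists v.
    by rewrite opr0 subr0.
  by exists (exist _ s' s'P).
pose s i := nat_rect (fun i => {s : op i | good i s}) (exist _ s0 s0_good)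
  (fun i s => sval (step i s)) i.
by exists (fun i => sval (s i)) => i v; rewrite /s /=; case: (step _ _).
Qed.

Variables (L : {pred A}) (F : min_graded_free_res L).

(* The augmented complex ... -> F_1 -> F_0 -> S, indexed so that F_i sits in
   degree i + 1. *)
Definition arank i := if i is j.+1 then rk F j else 1.

Definition adiff i : 'M[A]_(arank i.+1, arank i) :=
  match i with 0 => aug F | j.+1 => diff F j end.

Lemma adiff_exact i (v : 'rV_(arank i.+1)) :
  v *m adiff i = 0 <-> exists w : 'rV_(arank i.+2), v = w *m adiff i.+1.
Proof. case: i v => [|i] v; [exact: aug_exact | exact: diff_exact]. Qed.

Lemma adiffM i : adiff i.+1 *m adiff i = 0.
Proof.
apply/row_matrixP => x; rewrite row_mul row0.
by apply/adiff_exact; exists (delta_mx 0 x); rewrite -rowE.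
Qed.

Lemma res_mem0 : 0 \in L.
Proof. by apply/(aug_image F); exists 0; rewrite mul0mx mxE. Qed.

Lemma res_memMD c f g : f \in L -> g \in L -> c * f + g \in L.
Proof.
move=> /(aug_image F)[v <-] /(aug_image F)[w <-].
by apply/(aug_image F); exists (c *: v + w); rewrite mulmxDl -scalemxAl !mxE.
Qed.

(** The image of the augmentation is [L], so a projector onto [L] lifts through [aug F]. Since the
    projector fixes [L], the lift is a section over the image and starts the recursion. *)
Lemma res_contraction :
  exists s : forall i, 'I_(arank i) -> 'I_(arank i.+1) -> {linear A -> A},
    forall i (v : 'rV_(arank i.+1)),
      opr (s i.+1) v *m adiff i.+1 = v - opr (s i) (v *m adiff i).
Proof.
have [|rho [rhoL rho_id]] := @subspace_projector K n L res_mem0.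
  by move=> c f g fL gL; rewrite -mul_mpolyC res_memMD.
have [|||s0 s0E] := @operator_lift K n 1 1 (arank 1) (adiff 0)
  (fun v => \row_j rho (v 0 0)).
- by move=> u v; apply/rowP => j; rewrite !mxE raddfD.
- by move=> c v; apply/rowP => j; rewrite !mxE !mul_mpolyC linearZ.
- move=> v; have /(aug_image F)[w wE] := rhoL (v 0 0).
  by exists w; apply/rowP => j; rewrite (ord1 j) mxE -wE.
apply: (@contraction_exists arank adiff s0) => [v|]; last exact: adiff_exact.
rewrite s0E; apply/rowP => j; rewrite mxE (ord1 j) rho_id //.
by apply/(aug_image F); exists v.
Qed.

End ContractionExists.

(** * Coefficients in the first or second set of variables *)

Section TensorCoefficients.
Variables (K : fieldType) (n m N : nat).
Local Notation R := {mpoly K[n]}.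
Local Notation S := {mpoly K[N]}.
Local Notation T := {mpoly K[m]}.
Variables (h1 : {lrmorphism R -> S}) (h2 : {lrmorphism T -> S}).
Variable psi : {rmorphism S -> {mpoly R[m]}}.
Hypothesis psi_h1 : forall a, psi (h1 a) = a%:MP.
Hypothesis psi_h2 : forall b, psi (h2 b) = map_mpoly (@mpolyC n K) b.
Hypothesis tensor_ind : forall P : S -> Prop,
  P 0 -> (forall f g, P f -> P g -> P (f + g)) ->
  (forall a b, P (h1 a * h2 b)) -> forall f, P f.

(** The way back from [psi]: [h1] on coefficients, [h2] on variables. *)
Definition recombine : {mpoly R[m]} -> S := mmap h1 (fun j => h2 'X_j).

HB.instance Definition _ := GRing.RMorphism.on recombine.

(** This is [u (x) 1] on [S], seen as the tensor product of [R] and [T] over [K]: [u] is applied to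
    the coefficients in [R]. *)
Definition ext (u : {linear R -> R}) (f : S) : S :=
  recombine (map_mpoly u (psi f)).

Lemma mmap1_h2 beta : mmap1 (fun j => h2 'X_j) beta = h2 'X_[beta].
Proof.
rewrite /mmap1 mpolyXE_id rmorph_prod.
by apply: eq_bigr => j _; rewrite rmorphXn.
Qed.

Lemma recombine_map (u : {linear R -> R}) a beta :
  recombine (map_mpoly u (a *: 'X_[beta])) = h1 (u a) * h2 'X_[beta].
Proof.
have -> : map_mpoly u (a *: 'X_[beta]) = u a *: 'X_[beta].
  apply/mpolyP => k; rewrite mcoeff_map_mpoly !mcoeffZ !mcoeffX.
  by case: (beta == k); rewrite ?mulr1 ?mulr0 ?raddf0.
by rewrite /recombine mmapZ mmapX mmap1_h2.
Qed.

Lemma pure_sum a b :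
  h1 a * h2 b = \sum_(beta <- msupp b) h1 (b@_beta *: a) * h2 'X_[beta].
Proof.
rewrite [in LHS](mpolyE b) linear_sum mulr_sumr; apply: eq_bigr => beta _ /=.
by rewrite (linearZZ h2) (linearZZ h1) -scalerAr -scalerAl.
Qed.

Fact ext_is_linear u : linear (ext u).
Proof.
move=> c f g; rewrite /ext !raddfD /=; congr (_ + _).
have h1C x : h1 c%:MP * x = c *: x.
  rewrite (_ : c%:MP = c *: 1) ?(linearZZ h1) ?rmorph1 -?scalerAl ?mul1r //.
  by rewrite -mul_mpolyC mulr1.
rewrite -h1C rmorphM psi_h1 mul_mpolyC.
have -> : map_mpoly u (c%:MP *: psi f) = c%:MP *: map_mpoly u (psi f).
  apply/mpolyP => k; rewrite mcoeff_map_mpoly !mcoeffZ mcoeff_map_mpoly.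
  rewrite !mul_mpolyC; exact: linearZZ.
by rewrite /recombine mmapZ h1C.
Qed.

HB.instance Definition _ u :=
  GRing.isLinear.Build K S S _ (ext u) (ext_is_linear u).

Lemma ext_pure u a b : ext u (h1 a * h2 b) = h1 (u a) * h2 b.
Proof.
rewrite pure_sum [RHS]pure_sum linear_sum; apply: eq_bigr => beta _ /=.
rewrite /ext rmorphM psi_h1 psi_h2 map_mpolyX mul_mpolyC recombine_map.
by rewrite (linearZZ u).
Qed.

(** [u (x) 1] commutes with [1 (x) b]. Hence the homotopy of one complex commutes with the
    differential of the other. *)
Lemma ext_mul_h2 u b f : ext u (h2 b * f) = h2 b * ext u f.
Proof.
elim/tensor_ind: f => [|f g IHf IHg|a b'].
- by rewrite mulr0 raddf0 mulr0.
- by rewrite mulrDr !raddfD /= IHf IHg mulrDr.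
by rewrite mulrCA -rmorphM !ext_pure rmorphM mulrCA.
Qed.

Lemma map_scaled_delta p a (k : 'I_p) :
  map_mx h1 (a *: delta_mx 0 k : 'rV[R]_p) =
  h1 a *: delta_mx 0 k :> 'rV[S]_p.
Proof. by apply/rowP => j; rewrite !mxE rmorphM rmorph_nat. Qed.

Lemma tensor_row_ind p (P : 'rV[S]_p -> Prop) :
  P 0 -> (forall u v, P u -> P v -> P (u + v)) ->
  (forall b u, P (h2 b *: map_mx h1 u)) -> forall v, P v.
Proof.
move=> P0 PD PX v; rewrite (row_sum_delta v).
apply: big_ind => // k _; elim/tensor_ind: (v 0 k) => [|f g Pf Pg|a b].
- by rewrite scale0r.
- by rewrite scalerDl; apply: PD.
rewrite mulrC -scalerA.
by have := PX b (a *: delta_mx 0 k); rewrite map_scaled_delta.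
Qed.

Lemma opr_ext_pure p q (s : 'I_p -> 'I_q -> {linear R -> R}) b (u : 'rV_p) :
  opr (fun i j => ext (s i j)) (h2 b *: map_mx h1 u) =
  h2 b *: map_mx h1 (opr s u).
Proof.
apply/rowP => j; rewrite !mxE rmorph_sum mulr_sumr; apply: eq_bigr => i _.
by rewrite !mxE /= ext_mul_h2 -[h1 _]mulr1 -(rmorph1 h2) ext_pure rmorph1 mulr1.
Qed.

(** Both sides are additive in each row, so it suffices to treat rows [h2 b *: map_mx h1 u], where
    the identity is the given one for [u]. *)
Lemma ext_contraction (p : nat -> nat) (d : forall i, 'M[R]_(p i.+1, p i))
    (s : forall i, 'I_(p i) -> 'I_(p i.+1) -> {linear R -> R}) :
  (forall i (v : 'rV_(p i.+1)),
     opr (s i.+1) v *m d i.+1 = v - opr (s i) (v *m d i)) ->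
  forall i r (v : 'M[S]_(r, p i.+1)),
    opr (fun a b => ext (s i.+1 a b)) v *m map_mx h1 (d i.+1) =
    v - opr (fun a b => ext (s i a b)) (v *m map_mx h1 (d i)).
Proof.
move=> sE i r v.
have := @opr_ext_pure _ _ (s i); have := @opr_ext_pure _ _ (s i.+1).
move: (fun a b => ext (s i.+1 a b) : {linear S -> S}) => E'.
move: (fun a b => ext (s i a b) : {linear S -> S}) => E E'_pure E_pure.
apply/row_matrixP => x.
rewrite row_mul row_opr linearB /= row_opr row_mul.
move: (row x v); apply: tensor_row_ind => [|u w IHu IHw|b u].
- by rewrite mul0mx !opr0 mul0mx subr0.
- by rewrite mulmxDl (oprD E') (oprD E) mulmxDl IHu IHw opprD addrACA.
by rewrite E'_pure -!scalemxAl -!map_mxM E_pure sE map_mxB scalerBr.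
Qed.

(** The extension of the identity is the identity, by comparison on pure tensors; unfolding [ext]
    gives the expansion. *)
Lemma tensor_expand f :
  f = \sum_(beta <- msupp (psi f)) h1 (psi f)@_beta * h2 'X_[beta].
Proof.
have ext_id : ext idfun f = f.
  elim/tensor_ind: f => [|f g IHf IHg|a b]; first by rewrite raddf0.
    by rewrite raddfD /= IHf IHg.
  exact: ext_pure.
rewrite -[LHS]ext_id /ext (_ : map_mpoly _ _ = psi f).
  by apply: eq_bigr => beta _; rewrite mmap1_h2.
by apply/mpolyP => k; rewrite mcoeff_map_mpoly.
Qed.

End TensorCoefficients.

(** * The two inclusions and the two iterated polynomial rings *)

Section Inclusions.
Variables (K : fieldType) (n m : nat).
Local Notation S := {mpoly K[n + m]}.

HB.instance Definition _ := GRing.LRMorphism.copy (@incl_l K n m)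
  (comp_mpoly [tuple 'X_(lshift m i) | i < n]).
HB.instance Definition _ := GRing.LRMorphism.copy (@incl_r K n m)
  (comp_mpoly [tuple 'X_(rshift n i) | i < m]).

Lemma incl_lX i : @incl_l K n m 'X_i = 'X_(lshift m i).
Proof. by rewrite /incl_l comp_mpolyXU -tnth_nth tnth_mktuple. Qed.

Lemma incl_rX i : @incl_r K n m 'X_i = 'X_(rshift n i).
Proof. by rewrite /incl_r comp_mpolyXU -tnth_nth tnth_mktuple. Qed.

Definition mnm_l (mu : 'X_{1..n + m}) : 'X_{1..n} :=
  [multinom mu (lshift m i) | i < n].
Definition mnm_r (mu : 'X_{1..n + m}) : 'X_{1..m} :=
  [multinom mu (rshift n i) | i < m].

Lemma incl_split (mu : 'X_{1..n + m}) :
  'X_[mu] = incl_l m 'X_[mnm_l mu] * incl_r n 'X_[mnm_r mu] :> S.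
Proof.
rewrite !mpolyXE_id big_split_ord !rmorph_prod; congr (_ * _).
  by apply: eq_bigr => i _; rewrite rmorphXn /= incl_lX mnmE.
by apply: eq_bigr => i _; rewrite rmorphXn /= incl_rX mnmE.
Qed.

Lemma incl_ind (P : S -> Prop) :
  P 0 -> (forall f g, P f -> P g -> P (f + g)) ->
  (forall a b, P (incl_l m a * incl_r n b)) -> forall f, P f.
Proof.
move=> P0 PD PX f; rewrite (mpolyE f); apply: big_ind => // mu _.
rewrite incl_split scalerAl -(linearZZ (@incl_l K n m)); exact: PX.
Qed.

Lemma mpoly_rmorph_eq k (B : comNzRingType) (f g : {rmorphism {mpoly K[k]} -> B}) :
  (forall c, f c%:MP = g c%:MP) -> (forall i, f 'X_i = g 'X_i) -> f =1 g.
Proof.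
move=> fgC fgX p; rewrite (mpolyE p) !rmorph_sum; apply: eq_bigr => mu _ /=.
rewrite -mul_mpolyC !rmorphM fgC mpolyXE_id !rmorph_prod; congr (_ * _).
by apply: eq_bigr => i _; rewrite !rmorphXn /= fgX.
Qed.

(** [coef_l] reads [S] as polynomials in the y's over [K[x]], and [coef_r] as polynomials in the x's
    over [K[y]]. They play the role of [psi]. *)
Definition coef_l : S -> {mpoly {mpoly K[n]}[m]} :=
  mmap (@mpolyC m {mpoly K[n]} \o @mpolyC n K)
    (fun k => match split k with inl i => ('X_i)%:MP | inr j => 'X_j end).
Definition coef_r : S -> {mpoly {mpoly K[m]}[n]} :=
  mmap (@mpolyC n {mpoly K[m]} \o @mpolyC m K)
    (fun k => match split k with inl i => 'X_i | inr j => ('X_j)%:MP end).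

HB.instance Definition _ := GRing.RMorphism.on coef_l.
HB.instance Definition _ := GRing.RMorphism.on coef_r.

Lemma coef_l_incl_l a : coef_l (incl_l m a) = a%:MP.
Proof.
move: a; apply: (mpoly_rmorph_eq (f := coef_l \o @incl_l K n m)
  (g := @mpolyC m {mpoly K[n]})) => [c|i] /=.
  by rewrite /incl_l comp_mpolyC [LHS]mmapC.
by rewrite incl_lX /coef_l mmapX mmap1U (unsplitK (inl i)).
Qed.

Lemma coef_l_incl_r b : coef_l (incl_r n b) = map_mpoly (@mpolyC n K) b.
Proof.
move: b; apply: (mpoly_rmorph_eq (f := coef_l \o @incl_r K n m)
  (g := map_mpoly (@mpolyC n K))) => [c|i] /=.
  by rewrite /incl_r comp_mpolyC [LHS]mmapC map_mpolyC.
by rewrite incl_rX /coef_l mmapX mmap1U (unsplitK (inr i)) map_mpolyX.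
Qed.

Lemma coef_r_incl_r a : coef_r (incl_r n a) = a%:MP.
Proof.
move: a; apply: (mpoly_rmorph_eq (f := coef_r \o @incl_r K n m)
  (g := @mpolyC n {mpoly K[m]})) => [c|i] /=.
  by rewrite /incl_r comp_mpolyC [LHS]mmapC.
by rewrite incl_rX /coef_r mmapX mmap1U (unsplitK (inr i)).
Qed.

Lemma coef_r_incl_l b : coef_r (incl_l m b) = map_mpoly (@mpolyC m K) b.
Proof.
move: b; apply: (mpoly_rmorph_eq (f := coef_r \o @incl_l K n m)
  (g := map_mpoly (@mpolyC m K))) => [c|i] /=.
  by rewrite /incl_l comp_mpolyC [LHS]mmapC map_mpolyC.
by rewrite incl_lX /coef_r mmapX mmap1U (unsplitK (inl i)) map_mpolyX.
Qed.

End Inclusions.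

(** * Ideals and colons *)

Definition is_ideal (B : comNzRingType) (M : {pred B}) :=
  0 \in M /\ (forall a u v, u \in M -> v \in M -> a * u + v \in M).

Section IdealSpan.
Variable B : comNzRingType.
Implicit Types (G : B -> Prop) (M : {pred B}).

Lemma idealMl M a u : is_ideal M -> u \in M -> a * u \in M.
Proof. by case=> M0 MP uM; rewrite -[a * u]addr0; apply: MP. Qed.

Lemma idealD M u v : is_ideal M -> u \in M -> v \in M -> u + v \in M.
Proof. by case=> _ MP uM vM; rewrite -[u]mul1r; apply: MP. Qed.

Lemma ideal_sum M (I : Type) (r : seq I) (P : pred I) (F : I -> B) :
  is_ideal M -> (forall i, P i -> F i \in M) -> \sum_(i <- r | P i) F i \in M.
Proof.
move=> MP FM; apply: (big_ind (fun x => x \in M)) => //; first by case: MP.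
by move=> u v; exact: (idealD MP).
Qed.

Lemma mem_span G u : G u -> u \in ideal_span G.
Proof.
move=> Gu; apply/asboolP; exists [:: (1, u)]; split.
  by move=> c; rewrite inE => /eqP ->.
by rewrite big_seq1 mul1r.
Qed.

Lemma span_is_ideal G : is_ideal (ideal_span G).
Proof.
split=> [|a u v /asboolP[su [Gu ->]] /asboolP[sv [Gv ->]]]; apply/asboolP.
  by exists [::]; rewrite big_nil.
exists ([seq (a * c.1, c.2) | c <- su] ++ sv); split=> [c|].
  by rewrite mem_cat => /orP[/mapP[c' /Gu Gc ->] | /Gv].
rewrite big_cat big_map mulr_sumr; congr (_ + _).
by apply: eq_bigr => c _; rewrite mulrA.
Qed.

Lemma span_min G (M : {pred B}) u :
  is_ideal M -> (forall v, G v -> v \in M) -> u \in ideal_span G -> u \in M.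
Proof.
move=> MP GM /asboolP[s [Gs ->]]; rewrite big_seq.
by apply: ideal_sum => // c /Gs /GM; apply: idealMl.
Qed.

(** With this, a membership [h x * w \in M] needs checking only for generators [x] of an ideal. *)
Lemma preim_ideal (C : comNzRingType) (h : {rmorphism C -> B}) M w :
  is_ideal M -> is_ideal [pred x | h x * w \in M].
Proof.
move=> MP; split=> [|a u v]; rewrite !inE.
  by rewrite rmorph0 mul0r; case: MP.
by move=> uM vM; rewrite rmorphD rmorphM mulrDl -mulrA; case: MP => _; apply.
Qed.

End IdealSpan.

Section TensorIdeals.
Variables (K : fieldType) (n m : nat).
Local Notation R := {mpoly K[n]}.
Local Notation T := {mpoly K[m]}.
Local Notation S := {mpoly K[n + m]}.
Local Notation h1 := (@incl_l K n m).
Local Notation h2 := (@incl_r K n m).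

(** The product of the two extended ideals, presented by pure tensors as generators. *)
Definition tensor_ideal (L1 : {pred R}) (L2 : {pred T}) : {pred S} :=
  ideal_span (fun x => exists2 a, a \in L1 & exists2 b, b \in L2 &
    x = h1 a * h2 b).

Lemma mem_tensor_ideal (L1 : {pred R}) (L2 : {pred T}) a b :
  a \in L1 -> b \in L2 -> h1 a * h2 b \in tensor_ideal L1 L2.
Proof. by move=> aL bL; apply: mem_span; exists a => //; exists b. Qed.

Lemma tensor_span_sub (G1 : R -> Prop) (G2 : T -> Prop) (M : {pred S}) a b :
  is_ideal M -> (forall a b, G1 a -> G2 b -> h1 a * h2 b \in M) ->
  a \in ideal_span G1 -> b \in ideal_span G2 -> h1 a * h2 b \in M.
Proof.
move=> MP GM aG bG.
apply: (@span_min _ G1 [pred x | h1 x * h2 b \in M]) aG.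
  exact: preim_ideal.
move=> a' Ga' /=; rewrite inE mulrC.
apply: (@span_min _ G2 [pred x | h2 x * h1 a' \in M]) bG.
  exact: preim_ideal.
by move=> b' Gb' /=; rewrite inE mulrC; apply: GM.
Qed.

Lemma span_mul_sub (B : comNzRingType) (G1 G2 : B -> Prop) (M : {pred B}) a b :
  is_ideal M -> (forall a b, G1 a -> G2 b -> a * b \in M) ->
  a \in ideal_span G1 -> b \in ideal_span G2 -> a * b \in M.
Proof.
move=> MP GM aG bG.
apply: (@span_min _ G1 [pred x | x * b \in M]) aG.
  exact: (@preim_ideal _ _ idfun).
move=> a' Ga' /=; rewrite inE mulrC.
apply: (@span_min _ G2 [pred x | x * a' \in M]) bG.
  exact: (@preim_ideal _ _ idfun).
by move=> b' Gb' /=; rewrite inE mulrC; apply: GM.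
Qed.

(** Induction on [k]: both inclusions are checked on generators, where the factors from [R] and from
    [T] are regrouped by commutativity. *)
Lemma exp_tensor_ideal (I : {pred R}) (J : {pred T}) k :
  ideal_exp (ideal_mul (ideal_ext h1 I) (ideal_ext h2 J)) k =i
  tensor_ideal (ideal_exp I k) (ideal_exp J k).
Proof.
elim: k => [|k IH] f.
  rewrite [LHS]inE; apply/esym.
  rewrite -[f]mulr1; apply: (idealMl _ (span_is_ideal _)).
  by apply: mem_span; exists 1 => //; exists 1; rewrite // !rmorph1 mulr1.
apply/idP/idP; apply: span_min; try exact: span_is_ideal.
  move=> _ [x xX [y yE ->]]; move: yE; rewrite IH.
  apply: span_mul_sub xX; first exact: span_is_ideal.
  move=> _ _ [u uI [v vJ ->]] [a aI [b bJ ->]].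
  set w := h1 a * h2 b; set M := tensor_ideal _ _.
  (* With the generator [w] of the [k]-th power fixed, the condition on the remaining factor defines
     an ideal, so that factor may be taken to be a product of generators. *)
  apply: (span_mul_sub (M := [pred x | x * w \in M])) uI vJ.
    exact: (@preim_ideal _ _ idfun) (span_is_ideal _).
  move=> _ _ [a' a'I ->] [b' b'J ->]; rewrite inE /w mulrACA -!rmorphM.
  by apply: mem_tensor_ideal; apply: mem_span;
    [exists a' => //; exists a | exists b' => //; exists b].
move=> _ [a aI [b bJ ->]].
apply: (tensor_span_sub (span_is_ideal _)) aI bJ.
move=> _ _ [a1 a1I [a2 a2I ->]] [b1 b1J [b2 b2J ->]].
apply: mem_span; exists (h1 a1 * h2 b1).
  by apply: mem_span; exists (h1 a1); [|exists (h2 b1)] => //;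
    apply: mem_span; [exists a1 | exists b1].
exists (h1 a2 * h2 b2); first by rewrite IH mem_tensor_ideal.
by rewrite !rmorphM mulrACA.
Qed.

(** Polynomials with all coefficients in [L] form an ideal containing [h1 L]; conversely,
    [tensor_expand] writes [f] as a combination of its coefficients. *)
Lemma ext_coefP (L : {pred R}) f : is_ideal L ->
  reflect (forall beta, (coef_l f)@_beta \in L) (f \in ideal_ext h1 L).
Proof.
move=> LP; apply: (iffP idP) => [fL beta | fL].
  pose M := [pred g : S | `[< forall beta, (coef_l g)@_beta \in L >]].
  suff: f \in M by rewrite inE => /asboolP.
  apply: span_min fL.
    split=> [|a u v]; rewrite !inE.
      by apply/asboolP => k; rewrite rmorph0 mcoeff0; case: LP.
    move=> /asboolP uM /asboolP vM; apply/asboolP => k.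
    rewrite rmorphD rmorphM mcoeffD; apply: (idealD LP) (vM k).
    rewrite mcoeffM; apply: (ideal_sum _ LP) => c _.
    exact: (idealMl _ LP) (uM _).
  move=> _ [x xL ->]; rewrite inE; apply/asboolP => k.
  by rewrite coef_l_incl_l mcoeffC mulrC; apply: (idealMl _ LP).
rewrite (tensor_expand (@coef_l_incl_l K n m) (@coef_l_incl_r K n m)
  (@incl_ind K n m) f).
apply: ideal_sum; first exact: span_is_ideal.
move=> beta _; rewrite mulrC; apply: (idealMl _ (span_is_ideal _)).
by apply: mem_span; exists (coef_l f)@_beta.
Qed.

Lemma mem_ext (L : {pred R}) a : a \in L -> h1 a \in ideal_ext h1 L.
Proof. by move=> aL; apply: mem_span; exists a. Qed.

End TensorIdeals.

(* Discard the coefficients lying in p and compare leading coefficients. *)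
Lemma prime_coef (B : comNzRingType) k (p : {pred B}) (F G : {mpoly B[k]}) :
  prime_ideal p -> (forall mu, (F * G)@_mu \in p) ->
  (forall mu, F@_mu \in p) \/ (forall mu, G@_mu \in p).
Proof.
case=> [[p0 p1 pP] p_prime] FG.
have pI : is_ideal p by [].
pose trim (F : {mpoly B[k]}) := \sum_(mu <- msupp F | F@_mu \notin p) F@_mu *: 'X_[mu].
have trimE (H : {mpoly B[k]}) mu :
    (trim H)@_mu = if H@_mu \in p then 0 else H@_mu.
  rewrite /trim raddf_sum /=.
  have [inH | notH] := boolP (mu \in msupp H); last first.
    rewrite (memN_msupp_eq0 notH) p0 big_seq_cond big1 // => nu /andP[nuH _].
    rewrite mcoeffZ mcoeffX; case: eqP nuH notH => [-> -> //|_ _ _].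
    by rewrite mulr0.
  case: ifPn => Hmu.
    rewrite big1_seq // => nu /andP[nuH _]; rewrite mcoeffZ mcoeffX.
    by case: eqP nuH => [-> | _ _]; rewrite ?Hmu ?mulr0.
  rewrite big_mkcond (bigD1_seq mu) ?msupp_uniq //= Hmu.
  rewrite mcoeffZ mcoeffX eqxx mulr1 big1 ?addr0 // => nu /negPf nmu.
  by case: ifP => // _; rewrite mcoeffZ mcoeffX nmu mulr0.
have trim0 (H : {mpoly B[k]}) : trim H = 0 -> forall mu, H@_mu \in p.
  move=> H0 mu; have := trimE H mu; rewrite H0 mcoeff0.
  by case: ifP => // Hmu E; rewrite -E p0 in Hmu.
have trimP (H : {mpoly B[k]}) mu : (trim H - H)@_mu \in p.
  rewrite mcoeffB trimE; case: ifP => [Hp|_]; last by rewrite subrr.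
  by rewrite sub0r -mulN1r (idealMl _ pI).
have [/trim0|F0] := eqVneq (trim F) 0; first by left.
have [/trim0|G0] := eqVneq (trim G) 0; first by right.
have mulp (H H' : {mpoly B[k]}) : (forall mu, H@_mu \in p) -> forall mu, (H' * H)@_mu \in p.
  by move=> Hp mu; rewrite mcoeffM ideal_sum // => c _; rewrite (idealMl _ pI).
have := mleadcM (trim F) (trim G).
have : (trim F * trim G)@_(mlead (trim F) + mlead (trim G)) \in p.
  (* Modulo polynomials with coefficients in [p], trimming changes nothing, so the trimmed product
     inherits from [F * G] that its coefficients lie in [p]. *)
  have -> : trim F * trim G =
      F * G + F * (trim G - G) + trim G * (trim F - F).
    rewrite !mulrBr [F * G + _]addrC subrK (mulrC (trim G) F) addrC subrK.
    exact: mulrC.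
  by rewrite 2!mcoeffD !(idealD pI) // mulp.
move=> /[swap] -> /p_prime.
(* The leading coefficient of a nonzero trimmed polynomial lies outside [p], so the product of the
   two leading coefficients cannot lie in [p]. *)
rewrite -mleadc_eq0 trimE in F0; rewrite -mleadc_eq0 trimE in G0.
by rewrite !trimE; case: ifP F0 => [|->]; case: ifP G0 => [|->]; rewrite ?eqxx.
Qed.

Section ColonTensor.
Variables (K : fieldType) (n m : nat).
Local Notation R := {mpoly K[n]}.
Local Notation T := {mpoly K[m]}.
Local Notation h1 := (@incl_l K n m).
Local Notation h2 := (@incl_r K n m).
Variables (L1 : {pred R}) (L2 : {pred T}) (p : {pred R}).

Lemma ext_prime : prime_ideal p -> prime_ideal (ideal_ext h1 p).
Proof.
move=> p_prime; have [[p0 p1 pP] _] := p_prime.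
have pI : is_ideal p by [].
split; first split.
- by case: (span_is_ideal (fun y => exists2 x, x \in p & y = h1 x)).
- apply/negP => /(ext_coefP _ pI) /(_ 0%MM).
  by rewrite rmorph1 mcoeff1 eqxx (negPf p1).
- move=> a u v; case: (span_is_ideal (fun y => exists2 x, x \in p & y = h1 x)).
  by move=> _; apply.
move=> u v /(ext_coefP _ pI) uv.
have [up | vp] : (forall k, (coef_l u)@_k \in p) \/ (forall k, (coef_l v)@_k \in p).
- by apply: prime_coef => // k; rewrite -rmorphM.
- by apply/orP; left; apply/(ext_coefP _ pI).
- by apply/orP; right; apply/(ext_coefP _ pI).
Qed.

Lemma colon_tensor f g :
  is_ideal L1 -> prime_ideal p -> colon L1 f =i p -> g \in L2 -> g != 0 ->
  colon (tensor_ideal L1 L2) (h1 f * h2 g) =i ideal_ext h1 p.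
Proof.
move=> L1I p_prime fp gL g0 x; have [[p0 p1 pP] _] := p_prime.
have pI : is_ideal p by [].
apply/idP/idP => [|xp]; last first.
  apply: (@span_min _ _ [pred x | x * (h1 f * h2 g) \in tensor_ideal L1 L2]) xp.
    exact: (@preim_ideal _ _ idfun) (span_is_ideal _).
  move=> _ [a ap ->]; rewrite inE mulrA -rmorphM; apply: mem_tensor_ideal => //.
  by have := fp a; rewrite ap inE.
rewrite inE => xfg.
(* Forgetting the factor from [L2] leaves a condition over [L1] alone: the coefficients of
   [x * h2 g] lie in [(L1 : f) = p]. *)
have : x * (h1 f * h2 g) \in ideal_ext h1 L1.
  apply: span_min xfg; first exact: span_is_ideal.
  move=> _ [a aL [b _ ->]]; rewrite mulrC; apply: idealMl.
    exact: span_is_ideal.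
  exact: mem_ext.
have -> : x * (h1 f * h2 g) = (x * h2 g) * h1 f by rewrite mulrCA mulrC.
move=> /(ext_coefP _ L1I) xgf.
have [xp | gp] : (forall k, (coef_l x)@_k \in p) \/ (forall k, (coef_l (h2 g))@_k \in p).
- apply: prime_coef => // k; rewrite -rmorphM -fp inE.
  have := xgf k; rewrite [coef_l (_ * h1 f)]rmorphM /= coef_l_incl_l.
  by rewrite mulrC mcoeffCM mulrC.
- exact/(ext_coefP _ pI).
(* The coefficients of [h2 g] are constants from [K]; a nonzero one in [p] would be a unit and force
   [1] into [p]. *)
case/eqP: g0; apply/mpolyP => k; rewrite mcoeff0; apply/eqP.
have := gp k; rewrite coef_l_incl_r mcoeff_map_mpoly => gkp.
apply: contraNT p1 => gk0.
rewrite -(mpolyC1 n K) -(mulVf gk0) mpolyCM.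
exact: idealMl.
Qed.

End ColonTensor.

(** Minimising the degree over all primes and all [f] at once gives a prime whose local v-number is
    that minimum, so the v-number exists and is at most [e]. *)
Lemma vnumber_le (K : fieldType) N (L p : {pred {mpoly K[N]}}) f e :
  prime_ideal p -> f \is e.-homog -> colon L f =i p ->
  exists2 d, is_vnumber L d & (d <= e)%N.
Proof.
move=> p_prime fe fp.
pose P d := `[< exists (p : {pred {mpoly K[N]}}) f,
  [/\ prime_ideal p, f \is d.-homog & colon L f =i p] >].
have exP : exists d, P d by exists e; apply/asboolP; exists p, f.
case: (ex_minnP exP) => d /asboolP[q [g [q_prime gd gq]]] dmin.
exists d; last by apply: dmin; apply/asboolP; exists p, f.
have q_loc : is_local_vnumber L q d.
  split; first by exists g.
  by move=> e' f' f'e' f'q; apply: dmin; apply/asboolP; exists q, f'.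
split; first by exists q => //; split=> //; exists g.
move=> q' e' [q'_prime _] [[g' g'e' g'q'] _].
by apply: dmin; apply/asboolP; exists q', g'.
Qed.

(** * Degrees under the inclusions *)

Section InclDegree.
Variables (K : fieldType) (n N : nat) (lq : n.-tuple {mpoly K[N]}).
Hypothesis lq_homog : forall i, tnth lq i \is 1.-homog.

Lemma comp_mpoly_mdeg f mu : mu \in msupp (f \mPo lq) ->
  exists2 nu, nu \in msupp f & mdeg mu = mdeg nu.
Proof.
rewrite comp_mpolyEX => /msupp_sum_le /flattenP[s /mapP[nu nuf ->]].
rewrite mem_filter /= in nuf; move=> /msuppZ_le mu_nu.
exists nu => //; apply: (dhomog_mf _ mu_nu) => /=.
rewrite comp_mpolyX mdegE.
elim/big_rec2: _ => [|i d p _ pd]; first exact: dhomog1.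
apply: dhomogM => //; rewrite -[X in X.-homog]mul1n.
exact: dhomogMn (lq_homog i).
Qed.

End InclDegree.

Section Inclusions.
Variables (K : fieldType) (n m : nat).

Lemma incl_l_mdeg (f : {mpoly K[n]}) mu : mu \in msupp (incl_l m f) ->
  exists2 nu, nu \in msupp f & mdeg mu = mdeg nu.
Proof.
by apply: comp_mpoly_mdeg => i; rewrite tnth_mktuple dhomogX /= mdeg1.
Qed.

Lemma incl_r_mdeg (f : {mpoly K[m]}) mu : mu \in msupp (incl_r n f) ->
  exists2 nu, nu \in msupp f & mdeg mu = mdeg nu.
Proof.
by apply: comp_mpoly_mdeg => i; rewrite tnth_mktuple dhomogX /= mdeg1.
Qed.

Lemma incl_l_homog (f : {mpoly K[n]}) d :
  f \is d.-homog -> incl_l m f \is d.-homog.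
Proof.
by move=> fd; apply/dhomogP => mu /incl_l_mdeg[nu /(dhomog_mf fd) /= <- /= ->].
Qed.

Lemma incl_r_homog (f : {mpoly K[m]}) d :
  f \is d.-homog -> incl_r n f \is d.-homog.
Proof.
by move=> fd; apply/dhomogP => mu /incl_r_mdeg[nu /(dhomog_mf fd) /= <- /= ->].
Qed.

End Inclusions.

(** * Tensor product of contracted complexes *)

Section DoubleComplex.
Variables (K : fieldType) (B : comAlgType K).
Variables (p : nat -> nat) (d : forall i, 'M[B]_(p i.+1, p i)).
Variables (q : nat -> nat) (e : forall i, 'M[B]_(q i.+1, q i)).

(** Elements of a tensor product of complexes: the component in bidegree [(i, j)] is a matrix of
    coordinates. The differential [d] acts by its transpose on the left and [e] on the right, so the
    two commute by associativity. Index 0 of [p] and [q] is reserved for the target of the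
    augmentation, hence the shifts. *)
Definition family := forall i j, 'M[B]_(p i.+1, q j.+1).
Implicit Type z : family.

(** Component [(i, j)] receives contributions from [(i + 1, j)] and [(i, j + 1)]; the sign makes the
    mixed terms of the square cancel. *)
Definition tot_diff z : family := fun i j =>
  (d i.+1)^T *m z i.+1 j + (-1) ^+ i *: (z i j.+1 *m e j.+1).

Definition tot_aug z : 'M[B]_(p 0, q 0) := (d 0)^T *m z 0 0 *m e 0.

Hypothesis dM : forall i, d i.+1 *m d i = 0.
Hypothesis eM : forall j, e j.+1 *m e j = 0.

Let dTM i : (d i)^T *m (d i.+1)^T = 0.
Proof. by rewrite -trmx_mul dM trmx0. Qed.

Lemma tot_diffM z i j : tot_diff (tot_diff z) i j = 0.
Proof.
rewrite /tot_diff mulmxDr mulmxDl mulmxA dTM mul0mx add0r.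
rewrite -scalemxAl -(mulmxA (z _ _)) eM mulmx0 !scaler0 addr0 -scalemxAr.
by rewrite mulmxA exprS mulN1r scaleNr addNr.
Qed.

Lemma tot_augM z : tot_aug (tot_diff z) = 0.
Proof.
rewrite /tot_aug /tot_diff expr0 scale1r mulmxDr mulmxDl mulmxA dTM !mul0mx.
by rewrite add0r -!mulmxA eM !mulmx0.
Qed.

Variables (s : forall i, 'I_(p i) -> 'I_(p i.+1) -> {linear B -> B}).
Variables (t : forall j, 'I_(q j) -> 'I_(q j.+1) -> {linear B -> B}).
Hypothesis sE : forall i r (v : 'M[B]_(r, p i.+1)),
  opr (@s i.+1) v *m d i.+1 = v - opr (@s i) (v *m d i).
Hypothesis tE : forall j r (v : 'M[B]_(r, q j.+1)),
  opr (@t j.+1) v *m e j.+1 = v - opr (@t j) (v *m e j).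
Hypothesis s_e : forall i a b j x y f,
  @s i a b (e j x y * f) = e j x y * @s i a b f.
Hypothesis t_d : forall j a b i x y f,
  @t j a b (d i x y * f) = d i x y * @t j a b f.

(** [opl u] is [u (x) 1], acting on columns, as [opr u] is [1 (x) u]. *)
Let opl r c c' (u : 'I_c -> 'I_c' -> {linear B -> B}) (Z : 'M[B]_(c, r)) :=
  (opr u Z^T)^T.

Let oplE i r (Z : 'M[B]_(p i.+1, r)) :
  (d i.+1)^T *m opl (@s i.+1) Z = Z - opl (@s i) ((d i)^T *m Z).
Proof. by rewrite /opl -trmx_mul sE linearB /= trmxK trmx_mul trmxK. Qed.

Let oplMr i j (Z : 'M[B]_(p i, q j.+1)) :
  opl (@s i) (Z *m e j) = opl (@s i) Z *m e j.
Proof.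
rewrite /opl trmx_mul oprMl ?trmx_mul ?trmxK // => a b x y f.
by rewrite mxE s_e.
Qed.

Let oprMd j i (Z : 'M[B]_(p i.+1, q j)) :
  opr (@t j) ((d i)^T *m Z) = (d i)^T *m opr (@t j) Z.
Proof. by rewrite oprMl // => a b x y f; rewrite mxE t_d. Qed.

Let opl0 r c c' (u : 'I_c -> 'I_c' -> {linear B -> B}) :
  opl u (0 : 'M[B]_(c, r)) = 0.
Proof. by rewrite /opl trmx0 opr0 trmx0. Qed.

Let oplD r c c' (u : 'I_c -> 'I_c' -> {linear B -> B}) :
  {morph @opl r c c' u : X Y / X + Y}.
Proof. by move=> X Y; rewrite /opl !linearD /= oprD linearD. Qed.

Let oplN r c c' (u : 'I_c -> 'I_c' -> {linear B -> B}) :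
  {morph @opl r c c' u : X / - X}.
Proof. by move=> X; rewrite /opl !linearN /= oprN linearN. Qed.

Let opl_sign r c c' (u : 'I_c -> 'I_c' -> {linear B -> B}) k (X : 'M[B]_(c, r)) :
  opl u ((-1) ^+ k *: X) = (-1) ^+ k *: opl u X.
Proof.
by rewrite -signr_odd; case: (odd k); rewrite ?scaleN1r ?scale1r ?oplN.
Qed.

(* h = s (x) 1 + s_0 d_0 (x) t, where s_0 d_0 acts on the part of degree 0 *)
Definition homotopy z : family := fun i j =>
  match i, j return 'M[B]_(p i.+1, q j.+1) with
  | i'.+1, j => opl (@s i'.+1) (z i' j)
  | 0, j'.+1 => opl (@s 0) ((d 0)^T *m opr (@t j'.+1) (z 0 j'))
  | 0, 0 => 0
  end.

Lemma homotopyP z :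
  (forall i j, tot_diff z i j = 0) -> tot_aug z = 0 ->
  forall i j, tot_diff (homotopy z) i j = z i j.
Proof.
move=> Dz augz [|i] j; last first.
  (* For positive first index, the two correction terms combine to [s] applied to [tot_diff z i j],
     which vanishes. *)
  rewrite /tot_diff /= oplE -oplMr // exprS mulN1r scaleNr -opl_sign.
  by rewrite -addrA -opprD -oplD [X in opl _ X](Dz i j) opl0 subr0.
(* For first index 0, the error [s_0 d_0 z] left by [s] cancels against the [s_0 d_0 (x) t] part, up
   to one term containing [z 0 j *m e j]. *)
rewrite /tot_diff /= expr0 scale1r oplE -oplMr // -mulmxA tE mulmxBr oplD oplN.
rewrite addrA subrK.
suff -> : opl (@s 0) ((d 0)^T *m opr (@t j) (z 0 j *m e j)) = 0 by rewrite subr0.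
(* That term vanishes by the augmentation condition when [j = 0]. Otherwise the cycle condition
   rewrites [z 0 j.+1 *m e j.+1] as a boundary from the left complex, killed by [d 0]. *)
case: j => [|j].
  by rewrite -oprMd mulmxA [X in opr _ X]augz opr0 opl0.
have /eqP := Dz 0 j; rewrite /tot_diff expr0 scale1r addrC addr_eq0 => /eqP ->.
by rewrite oprN oprMd mulmxN mulmxA dTM mul0mx oppr0 opl0.
Qed.

End DoubleComplex.

Section TotIndex.
Variables p q : nat -> nat.

Definition tot_index k : finType :=
  {i : 'I_k.+1 & ('I_(p i) * 'I_(q (k - i)))%type}.

(** Positions are compared as natural numbers, which avoids casts between ['I_(q (k - i))] and
    ['I_(q j)]. *)
Definition at_pos k (x : tot_index k) (i j a b : nat) : bool :=
  [&& tag x == i :> nat, k - tag x == j, (tagged x).1 == a :> nat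
    & (tagged x).2 == b :> nat]%N.

Lemma at_pos_self k (x : tot_index k) :
  at_pos x (tag x) (k - tag x) (tagged x).1 (tagged x).2.
Proof. by rewrite /at_pos !eqxx. Qed.

Lemma at_pos_exists i j k (a : 'I_(p i)) (b : 'I_(q j)) :
  (i + j = k)%N -> exists x : tot_index k, at_pos x i j a b.
Proof.
move=> ijk; have lt_ik : (i < k.+1)%N by rewrite -ijk ltnS leq_addr.
have jE : j = (k - i)%N by rewrite -ijk addKn.
subst j; exists (existT _ (Ordinal lt_ik) (a, b)).
by rewrite /at_pos /= !eqxx.
Qed.

Lemma at_pos_sum k (x : tot_index k) i j a b : at_pos x i j a b -> (i + j = k)%N.
Proof. by case/and4P=> /eqP <- /eqP <- _ _; rewrite subnKC // -ltnS. Qed.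

Lemma at_pos_ext k (x : tot_index k) i j (a : 'I_(p i)) (b : 'I_(q j))
    (U : Type) (f : forall i j, 'I_(p i) -> 'I_(q j) -> U) :
  at_pos x i j a b -> f _ _ (tagged x).1 (tagged x).2 = f _ _ a b.
Proof.
case: x => i0 [a0 b0] /and4P[/= /eqP ei /eqP ej].
subst i j => /eqP ea /eqP eb.
by rewrite (val_inj ea) (val_inj eb).
Qed.

Lemma at_pos_inj k (x y : tot_index k) i j a b :
  at_pos x i j a b -> at_pos y i j a b -> x = y.
Proof.
case: x y => i0 [a0 b0] [i1 [a1 b1]].
move=> /and4P[/= /eqP ei /eqP ej /eqP ea /eqP eb].
subst i j a b => /and4P[/= /eqP/val_inj ei _].
by subst i1 => /eqP/val_inj -> /eqP/val_inj ->.
Qed.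

End TotIndex.

Section TotComplex.
Variables (K : fieldType) (B : comAlgType K).
Variables (p : nat -> nat) (d : forall i, 'M[B]_(p i.+1, p i)).
Variables (q : nat -> nat) (e : forall i, 'M[B]_(q i.+1, q i)).
Local Notation index := (tot_index (fun i => p i.+1) (fun j => q j.+1)).
Local Notation family := (family B p q).
Local Notation D := (tot_diff d e).

(** [fam] and [read] identify row vectors in total degree [k] with families supported on
    [i + j = k]. *)
Definition fam k (v : 'rV[B]_#|index k|) : family := fun i j =>
  \matrix_(a, b) \sum_c (at_pos (enum_val c) i j a b)%:R * v 0 c.

Definition read k (z : family) : 'rV[B]_#|index k| := \row_c
  let x : index k := enum_val c in z (tag x) (k - tag x)%N (tagged x).1 (tagged x).2.

Lemma famE k v (x : index k) i j (a : 'I_(p i.+1)) (b : 'I_(q j.+1)) :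
  at_pos x i j a b -> fam v i j a b = v 0 (enum_rank x).
Proof.
move=> xP; rewrite mxE (bigD1 (enum_rank x)) //= enum_rankK xP mul1r.
rewrite big1 ?addr0 // => c.
have [cP|_] := boolP (at_pos _ _ _ _ _); last by rewrite mul0r.
by rewrite -(at_pos_inj cP xP) enum_valK eqxx.
Qed.

Lemma fam_out k (v : 'rV_#|index k|) i j : (i + j != k)%N -> fam v i j = 0.
Proof.
move=> /eqP ijk; apply/matrixP => a b; rewrite !mxE big1 // => c _.
have [/at_pos_sum/ijk //|_] := boolP (at_pos _ _ _ _ _).
by rewrite mul0r.
Qed.

Lemma fam_delta k (x : index k) i j (a : 'I_(p i.+1)) (b : 'I_(q j.+1)) :
  fam (delta_mx 0 (enum_rank x)) i j a b = (at_pos x i j a b)%:R.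
Proof.
rewrite mxE (bigD1 (enum_rank x)) //= enum_rankK mxE !eqxx mulr1.
by rewrite big1 ?addr0 // => c /negPf nc; rewrite mxE nc andbF mulr0.
Qed.

Lemma fam_read k z i j : (i + j = k)%N -> fam (read k z) i j = z i j.
Proof.
move=> ijk; apply/matrixP => a b.
have [x xP] := @at_pos_exists (fun i => p i.+1) (fun j => q j.+1) i j k a b ijk.
rewrite (famE _ xP) mxE /= enum_rankK.
exact: (at_pos_ext (fun i j => z i j) xP).
Qed.

Lemma read_fam k v : read k (fam v) = v.
Proof.
apply/rowP => c; rewrite mxE /= (famE _ (at_pos_self _)) enum_valK //.
Qed.

Lemma eq_read k y z :
  (forall i j, (i + j = k)%N -> y i j = z i j) -> read k y = read k z.
Proof.
by move=> yz; apply/rowP => c; rewrite !mxE /= yz // subnKC // -ltnS.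
Qed.

Lemma read_linear k x y z :
  read k (fun i j => x *: y i j + z i j) = x *: read k y + read k z.
Proof. by apply/rowP => c; rewrite !mxE /= !mxE. Qed.

Lemma fam_linear k x (u v : 'rV_#|index k|) i j :
  fam (x *: u + v) i j = x *: fam u i j + fam v i j.
Proof.
apply/matrixP => a b; rewrite !mxE mulr_sumr -big_split; apply: eq_bigr => c _.
by rewrite !mxE mulrDr mulrCA.
Qed.

Definition tot_fun k (v : 'rV_#|index k.+1|) := read k (D (fam v)).

Fact tot_fun_linear k : linear (@tot_fun k).
Proof.
move=> x u v.
have DL i j : D (fam (x *: u + v)) i j = x *: D (fam u) i j + D (fam v) i j.
  rewrite /tot_diff !fam_linear mulmxDr mulmxDl scalerDr addrACA -scalemxAr.
  by rewrite -scalemxAl [_ ^+ _ *: (x *: _)]scalerA [_ * x]mulrC -scalerA -scalerDr.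
by rewrite /tot_fun -read_linear; apply: eq_read => i j _.
Qed.

HB.instance Definition _ k := GRing.isLinear.Build B _ _ _ (@tot_fun k)
  (@tot_fun_linear k).

Definition aug_fun (v : 'rV_#|index 0|) := tot_aug d e (fam v).

Fact aug_fun_linear : linear aug_fun.
Proof.
move=> x u v; rewrite /aug_fun /tot_aug fam_linear mulmxDr mulmxDl.
by rewrite -scalemxAr -scalemxAl.
Qed.

HB.instance Definition _ := GRing.isLinear.Build B _ _ _ aug_fun aug_fun_linear.

Definition tot_mx k := lin1_mx (@tot_fun k).

Lemma mul_tot_mx k v : v *m tot_mx k = read k (D (fam v)).
Proof. exact: (mul_rV_lin1 (@tot_fun k)). Qed.

Lemma mul_read_tot_mx k z : read k.+1 z *m tot_mx k = read k (D z).
Proof.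
rewrite mul_tot_mx; apply: eq_read => i j ijk.
by rewrite /tot_diff !fam_read ?addSn ?addnS ?ijk.
Qed.

(** Entries of the total differential are signed sums of entries of [d] and [e] between adjacent
    positions; homogeneity and minimality pass to the tensor product through this. *)
Lemma tot_mx_ind (P : B -> Prop) k (x : index k.+1) (y : index k) :
  P 0 -> (forall f g, P f -> P g -> P (f + g)) -> (forall f, P f -> P (- f)) ->
  (forall i j (a : 'I_(p i.+2)) (a' : 'I_(p i.+1)) (b : 'I_(q j.+1)),
     at_pos x i.+1 j a b -> at_pos y i j a' b -> P (d i.+1 a a')) ->
  (forall i j (a : 'I_(p i.+1)) (b : 'I_(q j.+2)) (b' : 'I_(q j.+1)),
     at_pos x i j.+1 a b -> at_pos y i j a b' -> P (e j.+1 b b')) ->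
  P (tot_mx k (enum_rank x) (enum_rank y)).
Proof.
move=> P0 PD PN Pd Pe; rewrite !mxE /= enum_rankK.
move: (at_pos_self y).
move: (tag y : nat) (k - tag y)%N (tagged y).1 (tagged y).2 => i j a b yP.
rewrite /tot_diff mxE; apply: (PD).
  rewrite mxE; apply: big_ind => // a' _; rewrite mxE fam_delta.
  have [xP|_] := boolP (at_pos x _ _ _ _); last by rewrite mulr0.
  by rewrite mulr1; apply: Pd xP yP.
rewrite mxE -signr_odd mulr_sign.
suff PX : P ((fam (delta_mx 0 (enum_rank x)) i j.+1 *m e j.+1) a b).
  by case: ifP => // _; apply: (PN).
rewrite mxE; apply: big_ind => // b' _; rewrite fam_delta.
have [xP|_] := boolP (at_pos x _ _ _ _); last by rewrite mul0r.
by rewrite mul1r; apply: Pe xP yP.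
Qed.

Hypothesis dM : forall i, d i.+1 *m d i = 0.
Hypothesis eM : forall j, e j.+1 *m e j = 0.
Variables (s : forall i, 'I_(p i) -> 'I_(p i.+1) -> {linear B -> B}).
Variables (t : forall j, 'I_(q j) -> 'I_(q j.+1) -> {linear B -> B}).
Hypothesis sE : forall i r (v : 'M[B]_(r, p i.+1)),
  opr (@s i.+1) v *m d i.+1 = v - opr (@s i) (v *m d i).
Hypothesis tE : forall j r (v : 'M[B]_(r, q j.+1)),
  opr (@t j.+1) v *m e j.+1 = v - opr (@t j) (v *m e j).
Hypothesis s_e : forall i a b j x y f,
  @s i a b (e j x y * f) = e j x y * @s i a b f.
Hypothesis t_d : forall j a b i x y f,
  @t j a b (d i x y * f) = d i x y * @t j a b f.

Lemma tot_cycle k (v : 'rV_#|index k|) :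
  (forall i j, D (fam v) i j = 0) -> tot_aug d e (fam v) = 0 ->
  exists w, v = w *m tot_mx k.
Proof.
move=> Dv augv; exists (read k.+1 (homotopy d s t (fam v))).
rewrite mul_read_tot_mx -[LHS]read_fam; apply: eq_read => i j _.
by rewrite (homotopyP dM sE tE s_e t_d).
Qed.

Lemma tot_exact k (v : 'rV_#|index k.+1|) :
  v *m tot_mx k = 0 <-> exists w, v = w *m tot_mx k.+1.
Proof.
split=> [vD | [w ->]].
  apply: tot_cycle => [i j|]; last first.
    (* In positive total degree the component at [(0, 0)] is zero, so the augmentation vanishes. *)
    by rewrite /tot_aug fam_out // mulmx0 mul0mx.
  have [ijk|ijk] := eqVneq (i + j)%N k.
    rewrite -(fam_read (D (fam v)) ijk) -mul_tot_mx vD.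
    by apply/matrixP => a b; rewrite !mxE big1 // => c _; rewrite mxE mulr0.
  by rewrite /tot_diff !fam_out ?mulmx0 ?mul0mx ?scaler0 ?addr0 // ?addSn ?addnS eqSS.
rewrite [w *m _]mul_tot_mx mul_read_tot_mx; apply/rowP => c.
by rewrite mxE /= (tot_diffM dM eM) !mxE.
Qed.

Lemma tot_exact0 (v : 'rV_#|index 0|) :
  tot_aug d e (fam v) = 0 <-> exists w, v = w *m tot_mx 0.
Proof.
split=> [v0 | [w ->]]; last first.
  rewrite mul_tot_mx -(tot_augM dM eM (fam w)) /tot_aug.
  by rewrite fam_read.
apply: tot_cycle => // i j.
by rewrite /tot_diff !fam_out ?mulmx0 ?mul0mx ?scaler0 ?addr0 // addnS.
Qed.

End TotComplex.

(** * The resolution of a product *)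

Lemma aug_mem (K : fieldType) n (L : {pred {mpoly K[n]}})
  (F : min_graded_free_res L) a : aug F a 0 \in L.
Proof. by apply/(aug_image F); exists (delta_mx 0 a); rewrite -rowE mxE. Qed.

Section TensorResolution.
Variables (K : fieldType) (n m : nat).
Local Notation R := {mpoly K[n]}.
Local Notation T := {mpoly K[m]}.
Local Notation S := {mpoly K[n + m]}.
Local Notation h1 := (@incl_l K n m).
Local Notation h2 := (@incl_r K n m).
Variables (L1 : {pred R}) (L2 : {pred T}).
Variables (F : min_graded_free_res L1) (G : min_graded_free_res L2).
Local Notation p := (arank F).
Local Notation q := (arank G).
Local Notation index := (tot_index (fun i => p i.+1) (fun j => q j.+1)).

Definition dl i : 'M[S]_(p i.+1, p i) := map_mx h1 (adiff F i).
Definition dr i : 'M[S]_(q i.+1, q i) := map_mx h2 (adiff G i).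

Lemma dlM i : dl i.+1 *m dl i = 0.
Proof. by rewrite -map_mxM adiffM map_mx0. Qed.

Lemma drM i : dr i.+1 *m dr i = 0.
Proof. by rewrite -map_mxM adiffM map_mx0. Qed.

Lemma dl_contraction :
  exists s : forall i, 'I_(p i) -> 'I_(p i.+1) -> {linear S -> S},
    (forall i r (v : 'M[S]_(r, p i.+1)),
      opr (@s i.+1) v *m dl i.+1 = v - opr (@s i) (v *m dl i)) /\
    (forall i a b g f, @s i a b (h2 g * f) = h2 g * @s i a b f).
Proof.
have [s sE] := res_contraction F.
exists (fun i a b => ext h1 h2 (@coef_l K n m) (s i a b)); split.
  apply: (ext_contraction (h1 := h1) (h2 := h2) (psi := @coef_l K n m) _ _ _ sE).
  - exact: coef_l_incl_l.
  - exact: coef_l_incl_r.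
  - exact: incl_ind.
move=> i a b g f; apply: ext_mul_h2.
- exact: coef_l_incl_l.
- exact: coef_l_incl_r.
- exact: incl_ind.
Qed.

Lemma dr_contraction :
  exists t : forall i, 'I_(q i) -> 'I_(q i.+1) -> {linear S -> S},
    (forall i r (v : 'M[S]_(r, q i.+1)),
      opr (@t i.+1) v *m dr i.+1 = v - opr (@t i) (v *m dr i)) /\
    (forall i a b g f, @t i a b (h1 g * f) = h1 g * @t i a b f).
Proof.
have ind (P : S -> Prop) : P 0 -> (forall f g, P f -> P g -> P (f + g)) ->
    (forall a b, P (h2 a * h1 b)) -> forall f, P f.
  by move=> P0 PD PX; apply: incl_ind => // a b; rewrite mulrC.
have [s sE] := res_contraction G.
exists (fun i a b => ext h2 h1 (@coef_r K n m) (s i a b)); split.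
  apply: (ext_contraction (h1 := h2) (h2 := h1) (psi := @coef_r K n m) _ _ _ sE) => //.
  - exact: coef_r_incl_r.
  - exact: coef_r_incl_l.
move=> i a b g f; apply: ext_mul_h2 => //.
- exact: coef_r_incl_r.
- exact: coef_r_incl_l.
Qed.

Definition tdeg k (x : index k) : nat :=
  (@deg _ _ _ F _ (tagged x).1 + @deg _ _ _ G _ (tagged x).2)%N.

Lemma tdegE k (x : index k) i j (a : 'I_(p i.+1)) (b : 'I_(q j.+1)) :
  at_pos x i j a b -> tdeg x = (@deg _ _ _ F i a + @deg _ _ _ G j b)%N.
Proof. by move=> /(at_pos_ext (fun i j a b => (@deg _ _ _ F i a + @deg _ _ _ G j b)%N)). Qed.

(** [p 0] and [q 0] reduce to 1, so the values of [aug_fun] are 1 by 1 matrices and may be read as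
    rows. *)
Definition taug : 'cV[S]_#|index 0| :=
  lin1_mx (aug_fun dl dr : 'rV_#|index 0| -> 'rV_1).

Lemma mul_taug v : v *m taug = tot_aug dl dr (fam v).
Proof. exact: (mul_rV_lin1 (aug_fun dl dr)). Qed.

Lemma tot_augE z : tot_aug dl dr z =
  (\sum_b (\sum_a h1 (aug F a 0) * z 0%N 0%N a b) * h2 (aug G b 0))%:M.
Proof.
apply/matrixP => x y; rewrite (ord1 x) (ord1 y) !mxE eqxx mulr1n.
apply: eq_bigr => b _; rewrite !mxE; congr (_ * _).
by apply: eq_bigr => a _; rewrite !mxE.
Qed.

Lemma taug_homog c : taug c 0 \is (tdeg (enum_val c : index 0)).-homog.
Proof.
rewrite -[c in taug c]enum_valK; move: (enum_val c) => x.
rewrite mxE /= /aug_fun tot_augE mxE eqxx mulr1n.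
apply: rpred_sum => b _; rewrite mulr_suml; apply: rpred_sum => a _.
rewrite fam_delta.
have [xP|_] := boolP (at_pos x _ _ _ _); last by rewrite mulr0 mul0r dhomog0.
rewrite mulr1 (tdegE xP); apply: dhomogM.
  exact/incl_l_homog/aug_homog.
exact/incl_r_homog/aug_homog.
Qed.

Lemma tdiff_homog k c c' mu : mu \in msupp (tot_mx dl dr k c c') ->
  (mdeg mu + tdeg (enum_val c' : index k) = tdeg (enum_val c : index k.+1))%N.
Proof.
rewrite -{1}[c]enum_valK -{1}[c']enum_valK.
move: (enum_val c) (enum_val c') => x y.
pose P (f : S) := forall mu, mu \in msupp f -> (mdeg mu + tdeg y = tdeg x)%N.
move: mu; rewrite -/(P _); apply: tot_mx_ind.
- by move=> mu; rewrite msupp0.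
- by move=> f g Pf Pg mu /msuppD_le; rewrite mem_cat => /orP[/Pf | /Pg].
- by move=> f Pf mu; rewrite (perm_mem (msuppN f)) => /Pf.
- move=> i j a a' b xP yP mu; rewrite mxE => /incl_l_mdeg[nu nuP ->].
  by rewrite (tdegE xP) (tdegE yP) addnA (diff_homog nuP).
move=> i j a b b' xP yP mu; rewrite mxE => /incl_r_mdeg[nu nuP ->].
by rewrite (tdegE xP) (tdegE yP) addnCA (diff_homog nuP).
Qed.

(** The inclusions preserve degrees of monomials, so a constant term would come from one in [diff F]
    or [diff G]. *)
Lemma tdiff_minimal k c c' : (tot_mx dl dr k c c')@_0%MM = 0.
Proof.
rewrite -[c]enum_valK -[c']enum_valK.
apply: (tot_mx_ind (P := fun f : S => f@_0%MM = 0)).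
- by rewrite mcoeff0.
- by move=> f g f0 g0; rewrite mcoeffD f0 g0 addr0.
- by move=> f f0; rewrite mcoeffN f0 oppr0.
- move=> i j a a' b _ _; rewrite mxE; apply/eqP; rewrite mcoeff_eq0.
  apply/negP => /incl_l_mdeg[nu nuP]; rewrite mdeg0 => /esym/eqP.
  by rewrite mdeg_eq0 => /eqP nu0; move: nuP; rewrite nu0 mcoeff_msupp diff_minimal eqxx.
move=> i j a b b' _ _; rewrite mxE; apply/eqP; rewrite mcoeff_eq0.
apply/negP => /incl_r_mdeg[nu nuP]; rewrite mdeg0 => /esym/eqP.
by rewrite mdeg_eq0 => /eqP nu0; move: nuP; rewrite nu0 mcoeff_msupp diff_minimal eqxx.
Qed.

Lemma tot_exactE k (v : 'rV[S]_#|index k.+1|) :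
  v *m tot_mx dl dr k = 0 <-> exists w, v = w *m tot_mx dl dr k.+1.
Proof.
have [s [sE s_r]] := dl_contraction; have [t [tE t_l]] := dr_contraction.
apply: (tot_exact dlM drM sE tE) => *; rewrite mxE; [exact: s_r | exact: t_l].
Qed.

Lemma taug_exact (v : 'rV[S]_#|index 0|) :
  v *m taug = 0 <-> exists w, v = w *m tot_mx dl dr 0.
Proof.
have [s [sE s_r]] := dl_contraction; have [t [tE t_l]] := dr_contraction.
rewrite mul_taug.
apply: (tot_exact0 dlM drM sE tE) => *; rewrite mxE; [exact: s_r | exact: t_l].
Qed.

Lemma taug_image f : f \in tensor_ideal L1 L2 <-> exists v : 'rV_#|index 0|, (v *m taug) 0 0 = f.
Proof.
split=> [|[v <-]]; last first.
  have idM : is_ideal (tensor_ideal L1 L2) := span_is_ideal _.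
  rewrite mul_taug tot_augE mxE eqxx mulr1n; apply: (ideal_sum _ idM) => b _.
  rewrite mulr_suml; apply: (ideal_sum _ idM) => a _.
  rewrite mulrAC mulrC; apply: (idealMl _ idM).
  by apply: mem_tensor_ideal; apply: aug_mem.
pose M : {pred S} := [pred f | `[< exists v : 'rV_#|index 0|, (v *m taug) 0 0 = f >]].
suff: f \in tensor_ideal L1 L2 -> f \in M by move=> fM /fM /asboolP.
apply: span_min.
  split=> [|a u v /asboolP[x <-] /asboolP[y <-]]; apply/asboolP.
    by exists 0; rewrite mul0mx mxE.
  by exists (a *: x + y); rewrite mulmxDl -scalemxAl !mxE.
move=> _ [a /(aug_image F)[x <-] [b /(aug_image G)[y <-] ->]].
(* The rank one matrix [Z] is [x (x) y], which the augmentation sends to the product of the images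
   of [x] and [y]. *)
pose Z : 'M[S]_(p 1, q 1) := (map_mx h1 x)^T *m map_mx h2 y.
pose z : family S p q := fun i j => match i, j return 'M[S]_(p i.+1, q j.+1) with
  | 0, 0 => Z | _, _ => 0 end.
apply/asboolP; exists (read 0 z).
rewrite mul_taug /tot_aug fam_read // /Z.
have -> : (dl 0)^T *m ((map_mx h1 x)^T *m map_mx h2 y) *m dr 0 =
    (map_mx h1 (x *m aug F))^T *m map_mx h2 (y *m aug G).
  by rewrite !map_mxM trmx_mul !mulmxA.
by rewrite mxE big_ord1 !mxE.
Qed.

Definition tensor_res : min_graded_free_res (tensor_ideal L1 L2) :=
  MinGradedFreeRes taug_homog tdiff_homog taug_image taug_exact tot_exactE
    tdiff_minimal.

End TensorResolution.

(** * Regularity and v-number of a product *)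

Lemma tensor_regularity (K : fieldType) (n m : nat) (L1 : {pred {mpoly K[n]}})
    (L2 : {pred {mpoly K[m]}}) r1 r2 :
  is_regularity L1 r1 -> is_regularity L2 r2 ->
  is_regularity (tensor_ideal L1 L2) (r1 + r2).
Proof.
move=> [F [[i [a aE]] F_le]] [G [[j [b bE]] G_le]].
exists (tensor_res F G); split.
  (* Twists and homological positions both add, so the pair of extremal summands, in position
     [i + j], attains [r1 + r2]. *)
  have [x xP] := @at_pos_exists (rk F) (rk G) i j _ a b erefl.
  exists (i + j)%N, (enum_rank x).
  rewrite [LHS](_ : _ = tdeg (enum_val (enum_rank x))) // enum_rankK.
  by rewrite (tdegE xP) aE bE addnACA.
move=> k c; change (tdeg (enum_val c) <= r1 + r2 + k)%N.
move: (enum_val c) => x.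
have := leq_add (F_le _ (tagged x).1) (G_le _ (tagged x).2).
by rewrite addnACA subnKC // -ltnS.
Qed.

Lemma predE (T : Type) (P Q : {pred T}) : P =i Q -> P = Q.
Proof. by move=> PQ; apply: funext => x; exact: PQ. Qed.

Lemma tensor_vnumber_lt_reg (K : fieldType) (n m : nat)
    (L1 : {pred {mpoly K[n]}}) (L2 : {pred {mpoly K[m]}}) :
  vnumber_lt_reg L1 -> vnumber_lt_reg L2 -> (exists2 g, g \in L2 & g != 0) ->
  vnumber_lt_reg (tensor_ideal L1 L2).
Proof.
move=> [d1 [r1 [[[p [p_prime _] [[f fd fp] _]] _] reg1 lt1]]].
move=> [_ [r2 [_ reg2 _]]] [g gL g0].
have [F _] := reg1; have [G [_ G_le]] := reg2.
have L1I : is_ideal L1.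
  by split; [exact: (res_mem0 F) | move=> *; exact: (res_memMD F)].
(* As [L2] is nonzero, some minimal generator is nonzero; sitting in homological position 0, it has
   degree at most [r2]. *)
have [b gb0] : exists b, aug G b 0 != 0.
  apply/existsP; apply: contraNT g0; rewrite negb_exists => /forallP aug0.
  have [v <-] := (aug_image G g).1 gL.
  rewrite mxE big1 // => b _; have := aug0 b; rewrite negbK => /eqP ->.
  by rewrite mulr0.
have [d dv d_le] := vnumber_le (ext_prime m p_prime)
  (dhomogM (incl_l_homog m fd) (incl_r_homog n (aug_homog b)))
  (colon_tensor L1I p_prime fp (aug_mem b) gb0).
exists d, (r1 + r2)%N; split=> //; first exact: tensor_regularity.
apply: leq_ltn_trans d_le _; rewrite -addSn; apply: leq_add => //.
by have := G_le 0%N b; rewrite addn0.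
Qed.

Lemma exp_nonzero (B : idomainType) (L : {pred B}) k :
  (exists2 g, g \in L & g != 0) -> exists2 g, g \in ideal_exp L k & g != 0.
Proof.
move=> [g gL g0]; elim: k => [|k [h hL h0]]; first by exists 1; rewrite ?oner_neq0.
exists (g * h); last exact: mulf_neq0.
by apply: mem_span; exists g => //; exists h.
Qed.

Theorem corollary2p4 (K : fieldType) (n m : nat)
    (I : {pred {mpoly K[n]}}) (J : {pred {mpoly K[m]}})
    (I_proper_ideal : idealr_closed I) (I_homog : homogeneous_ideal I)
    (I_nonzero : exists2 f, f \in I & f != 0)
    (J_proper_ideal : idealr_closed J) (J_homog : homogeneous_ideal J)
    (J_nonzero : exists2 g, g \in J & g != 0)
    (I_lt : exists k0, forall k, (k0 <= k)%N -> vnumber_lt_reg (ideal_exp I k))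
    (J_lt : exists k0, forall k, (k0 <= k)%N -> vnumber_lt_reg (ideal_exp J k)) :
  exists k0, forall k, (k0 <= k)%N ->
    vnumber_lt_reg
      (ideal_exp (ideal_mul (ideal_ext (@incl_l K n m) I)
                            (ideal_ext (@incl_r K n m) J)) k).
Proof.
have [[k1 I_ltk] [k2 J_ltk]] := (I_lt, J_lt).
exists (maxn k1 k2) => k; rewrite geq_max => /andP[k1k k2k].
rewrite (predE (exp_tensor_ideal I J k)).
apply: tensor_vnumber_lt_reg (I_ltk k k1k) (J_ltk k k2k) _.
exact: exp_nonzero.
Qed.
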